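(* Let $X=\bigsqcup_{\lambda\in\Lambda}G_\lambda$ be a multiple conjugation quandle. If there exists $n\in\mathbb{Z}_{\ge0}$ such that $D^n(\{\Lambda\})=D^{n+1}(\{\Lambda\})$, then $$X=\bigsqcup_{\Lambda'\in D^n(\{\Lambda\})}\Big(\bigsqcup_{\lambda\in\Lambda'}G_\lambda\Big)$$ is the maximal connected sub-multiple conjugation quandle decomposition of $X$. In particular, if $\Lambda$ is a finite set, then there exists $n\in\mathbb{Z}_{\ge0}$ such that $X=\bigsqcup_{\Lambda'\in D^n(\{\Lambda\})}\big(\bigsqcup_{\lambda\in\Lambda'}G_\lambda\big)$ is the maximal connected sub-multiple conjugation quandle decomposition of $X$.
   Context: A multiple conjugation quandle (MCQ) is a disjoint union $X=\bigsqcup_{\lambda\in\Lambda}G_\lambda$ of groups $G_\lambda$ with a binary operation $*:X\times X\to X$ such that: (i) $a*b=b^{-1}ab$ for $a,b\in G_\lambda$; (ii) $x*e_\lambda=x$ and $x*(ab)=(x*a)*b$ for $x\in X$, $a,b\in G_\lambda$, where $e_\lambda$ is the identity of $G_\lambda$; (iii) $(x*y)*z=(x*z)*(y*z)$ for $x,y,z\in X$; (iv) for $x\in X$ and $a,b\in G_\lambda$, the elements $a*x,b*x$ lie in a common $G_\mu$ and $(ab)*x=(a*x)(b*x)$. A sub-multiple conjugation quandle of $X$ is a non-empty subset $Y$ that is itself an MCQ under $*$ and the group operations of $X$. An automorphism of $X$ is a bijection $\phi:X\to X$ with $\phi(x*y)=\phi(x)*\phi(y)$ for all $x,y \in X$ and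 $\phi(ab)=\phi(a)\phi(b)$ whenever $a,b$ lie in the same $G_\lambda$. For $a\in X$, $S_a(x)=x*a$ is an automorphism of $X$; $\mathrm{Inn}(X)$ is the group of automorphisms generated by $\{S_a\mid a\in X\}$. It acts on the index set $\Lambda$ by $e_{\lambda\cdot g}=g(e_\lambda)$; $\mathrm{Orb}_\Lambda(\mu)$ denotes the orbit of $\mu\in\Lambda$. For an orbit $\Lambda'$ of $\Lambda$, $\bigsqcup_{\lambda\in\Lambda'}G_\lambda$ is a sub-MCQ of $X$. $X$ is connected if the action on $\Lambda$ is transitive. A sub-MCQ of $X$ is connected if it is connected as an MCQ in its own right. A connected sub-MCQ $A$ of $X$ is a maximal connected sub-multiple conjugation quandle of $X$ if the only connected sub-MCQ of $X$ including $A$ is $A$ itself. $X=\bigsqcup_{i\in I}A_i$ is called the maximal connected sub-multiple conjugation quandle decomposition of $X$ when each $A_i$ is a maximal connected sub-multiple conjugation quandle of $X$ (every MCQ has exactly one such decomposition). For a set $\mathcal{A}$ of subsets $\Lambda'$ of $\Lambda$ (for which $\bigsqcup_{\lambda\in\Lambda'}G_\lambda$ is a sub-MCQ of $X$), define $D(\mathcal{A}):=\bigcup_{\Lambda'\in\mathcal{A}}\{\mathrm{Orb}_{\Lambda'}(\mu)\mid\mu\in\Lambda'\}$, where $\mathrm{Orb}_{\Lambda'}(\mu)$ is the orbit of $\mu$ under the action on $\Lambda'$ of $\mathrm{Inn}(\bigsqcup_{\lambda\in\Lambda'}G_\lambda)$. Put $D^0(\mathcal{A}):=\mathcal{A}$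 and $D^{k+1}(\mathcal{A}):=D(D^k(\mathcal{A}))$ for $k\in\mathbb{Z}_{\ge0}$. *)

(* Defs.v *)
(* Written with Mathematical Components and its classical-sets library. *)
From HB Require Import structures.
From mathcomp Require Import all_boot.
From mathcomp Require Import boolp classical_sets.

Set Implicit Arguments.
Unset Strict Implicit.
Unset Printing Implicit Defensive.

Local Open Scope classical_set_scope.
Local Open Scope group_scope.

Section Laws.
Variables (L : Type) (G : L -> groupType).
Variable op : {l : L & G l} -> {l : L & G l} -> {l : L & G l}.

Record mcq_laws : Prop := MCQLaws {
  op_conj : forall (l : L) (a b : G l),
    op (Tagged G a) (Tagged G b) = Tagged G (b^-1 * a * b);
  op_one : forall (x : {l : L & G l}) (l : L), op x (Tagged G (1 : G l)) = x;
  op_mul : forall (x : {l : L & G l}) (l : L) (a b : G l),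
    op x (Tagged G (a * b)) = op (op x (Tagged G a)) (Tagged G b);
  op_dist : forall x y z : {l : L & G l}, op (op x y) z = op (op x z) (op y z);
  op_morph : forall (x : {l : L & G l}) (l : L) (a b : G l),
    exists (m : L) (a' b' : G m),
      [/\ op (Tagged G a) x = Tagged G a',
          op (Tagged G b) x = Tagged G b' &
          op (Tagged G (a * b)) x = Tagged G (a' * b')]
}.

End Laws.

(* A multiple conjugation quandle; its underlying set is the disjoint union
   [{l : idx & grp l}], in which [Tagged grp a] is the element [a : grp l]. *)
Record mcq := MCQ {
  idx : Type;
  grp : idx -> groupType;
  op : {l : idx & grp l} -> {l : idx & grp l} -> {l : idx & grp l};
  mcqP : mcq_laws op
}.

Arguments idx : clear implicits.
Arguments grp : clear implicits.

Definition elt (X : mcq) : Type := {l : idx X & grp X l}.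

Definition unit_at (X : mcq) (l : idx X) : elt X := Tagged (grp X) (1 : grp X l).

Lemma Tagged_inj (L : Type) (G : L -> Type) (l : L) :
  injective (fun a : G l => Tagged G a).
Proof. by move=> a b /(@existT_inj2 {classic L} G l a b). Qed.

Section Automorphisms.
Variable X : mcq.

Definition translation (a : elt X) : elt X -> elt X := fun x => op x a.

(* The law "phi (a b) = phi a phi b" includes that phi a and phi b belong to
   the same group. *)
Record is_aut (phi : elt X -> elt X) : Prop := IsAut {
  aut_bij : bijective phi;
  aut_op : forall x y : elt X, phi (op x y) = op (phi x) (phi y);
  aut_mul : forall (l : idx X) (a b : grp X l),
    exists (m : idx X) (a' b' : grp X m),
      [/\ phi (Tagged (grp X) a) = Tagged (grp X) a',
          phi (Tagged (grp X) b) = Tagged (grp X) b' &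
          phi (Tagged (grp X) (a * b)) = Tagged (grp X) (a' * b')]
}.

Record aut_subgroup (H : set (elt X -> elt X)) : Prop := AutSubgroup {
  asg_aut : H `<=` is_aut;
  asg_id : H id;
  asg_comp : forall f g, H f -> H g -> H (g \o f);
  asg_inv : forall f g, H f -> cancel f g -> cancel g f -> H g
}.

(* [translation_aut] and [aut_subgroup_aut] below show that this intersection
   ranges over a nonempty family. *)
Definition Inn : set (elt X -> elt X) :=
  smallest aut_subgroup (range translation).

(* The right action l . g of Inn on the indices is determined by
   unit_at (l . g) = g (unit_at l). *)
Definition Orb (m : idx X) : set (idx X) :=
  [set l | exists2 g, Inn g & unit_at l = g (unit_at m)].

Definition connected_mcq : Prop := forall m l : idx X, Orb m l.

Lemma translation_aut (a : elt X) : is_aut (translation a).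
Proof.
have [_ op1 opM opD opm] := mcqP X; split; last first.
- by move=> l b c; apply: opm.
- by move=> x y; apply: opD.
case: a => l a; exists (translation (Tagged (grp X) a^-1)) => x.
  by rewrite /translation -opM mulgV op1.
by rewrite /translation -(opM x l a^-1 a) mulVg op1.
Qed.

Lemma aut_unit (f : elt X -> elt X) (l m : idx X) (a : grp X l) (b : grp X m) :
  is_aut f -> f (Tagged (grp X) a) = Tagged (grp X) b ->
  f (unit_at l) = unit_at m.
Proof.
move=> [_ _ fM] fab; have [k [u [v [fu fv]]]] := fM l 1 a.
rewrite mul1g fv => fuv.
have u1 : 1 = u by apply: (mulIg v); rewrite mul1g; exact: Tagged_inj fuv.
move: fab; rewrite fv => /(congr1 (@projT1 _ _)) /= km; subst m.
by rewrite /unit_at fu -u1.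
Qed.

Lemma aut_subgroup_aut : aut_subgroup is_aut.
Proof.
split => //.
- by split=> // [|l a b]; [exists id | exists l, a, b].
- move=> f g [fb fo fm] [gb go gm]; split.
  + exact: bij_comp.
  + by move=> x y /=; rewrite fo go.
  + move=> l a b; have [m [a' [b' [fa fb' fab]]]] := fm l a b.
    have [k [a2 [b2 [ga gb' gab]]]] := gm m a' b'.
    by exists k, a2, b2; split; rewrite /= ?fa ?fb' ?fab.
- move=> f g f_aut fK gK; have [_ fo fm] := f_aut; split; first by exists f.
    by move=> x y; rewrite -{1}[x]gK -{1}[y]gK -fo fK.
  move=> l a b.
  case Ea : (g (Tagged (grp X) a)) => [m a'].
  case Eb : (g (Tagged (grp X) b)) => [m' b'].
  have fa : f (Tagged (grp X) a') = Tagged (grp X) a by rewrite -[RHS]gK Ea.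
  have fb : f (Tagged (grp X) b') = Tagged (grp X) b by rewrite -[RHS]gK Eb.
  have /(can_inj fK)/(congr1 (@projT1 _ _))/= mm' :
      f (unit_at m) = f (unit_at m').
    by rewrite (aut_unit f_aut fa) (aut_unit f_aut fb).
  subst m'; exists m, a', b'; split=> //.
  have [k [u [v [fu fv fuv]]]] := fm m a' b'; rewrite -[RHS]fK fuv.
  have au : Tagged (grp X) a = Tagged (grp X) u by rewrite -fa.
  have bv : Tagged (grp X) b = Tagged (grp X) v by rewrite -fb.
  have lk : l = k := congr1 (@projT1 _ _) au; subst k.
  by rewrite (Tagged_inj au) (Tagged_inj bv).
Qed.

End Automorphisms.

Section SubMCQ.
Variables (X : mcq) (Y : set (elt X)).

Definition fibre (l : idx X) : set (grp X l) := [set a | Y (Tagged (grp X) a)].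
Arguments fibre : clear implicits.

(* Y is closed under the operation and meets each group in a subgroup or not at
   all; [mcq_of_sub] equips Y with the restricted operations and shows that it
   is then an MCQ, the laws being inherited. *)
Record sub_mcq : Prop := SubMCQ {
  sub_neq0 : Y !=set0;
  sub_op : forall x y : elt X, Y x -> Y y -> Y (op x y);
  sub_grp : forall l : idx X, fibre l !=set0 -> group_closed (mem (fibre l))
}.

Hypothesis subY : sub_mcq.

(* Only the groups that meet Y contribute to the decomposition of Y. *)
Definition sub_idx : Type := {l : idx X | fibre l !=set0}.

Definition sub_car of sub_mcq := fun l : sub_idx => {a | a \in fibre (sval l)}.

HB.instance Definition _ l := SubChoice.on (sub_car subY l).
HB.instance Definition _ l :=
  SubChoice_isSubGroup.Build _ _ (sub_car subY l) (sub_grp subY (svalP l)).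

Definition sub_el : Type := {l : sub_idx & sub_car subY l}.

Definition sub_val (u : sub_el) : elt X := Tagged (grp X) (val (tagged u)).

Lemma sub_valP (u : sub_el) : Y (sub_val u).
Proof. by have := valP (tagged u); rewrite inE. Qed.

Definition sub_mk (x : elt X) : Y x -> sub_el :=
  match x return Y x -> sub_el with
  | existT l a => fun Ya => existT (sub_car subY)
      (exist _ l (ex_intro _ a Ya)) (exist _ a (mem_set Ya))
  end.

Lemma sub_mkK (x : elt X) (Yx : Y x) : sub_val (sub_mk Yx) = x.
Proof. by case: x Yx. Qed.

Lemma sub_val_inj : injective sub_val.
Proof.
move=> [[l p] [a aY]] [[m q] [b bY]]; rewrite /sub_val /= => ab.
have lm : l = m := congr1 (@projT1 _ _) ab; subst m.
have {}ab : a = b := Tagged_inj ab; subst b.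
by rewrite (Prop_irrelevance q p) (bool_irrelevance bY aY).
Qed.

Definition sub_mcq_op (u v : sub_el) : sub_el :=
  sub_mk (sub_op subY (sub_valP u) (sub_valP v)).

Lemma sub_mcqP : mcq_laws sub_mcq_op.
Proof.
have [opJ op1 opM opD opm] := mcqP X.
have vE u v : sub_val (sub_mcq_op u v) = op (sub_val u) (sub_val v).
  exact: sub_mkK.
have vT l (a : sub_car subY l) :
  sub_val (Tagged (sub_car subY) a) = Tagged (grp X) (val a) by [].
split.
- by move=> l a b; apply: sub_val_inj; rewrite vE !vT opJ !valM.
- by move=> x l; apply: sub_val_inj; rewrite vE vT val1 op1.
- by move=> x l a b; apply: sub_val_inj; rewrite !vE !vT valM opM.
- by move=> x y z; apply: sub_val_inj; rewrite !vE opD.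
- move=> x l a b.
  have [m [a' [b' [xa xb xab]]]] := opm (sub_val x) _ (val a) (val b).
  have Ya : a' \in fibre m.
    by rewrite inE /fibre /mkset -xa -vT -vE; apply: sub_valP.
  have Yb : b' \in fibre m.
    by rewrite inE /fibre /mkset -xb -vT -vE; apply: sub_valP.
  have ne : fibre m !=set0 by exists a'; rewrite inE in Ya.
  exists (exist _ m ne), (exist _ a' Ya), (exist _ b' Yb).
  by split; apply: sub_val_inj; rewrite vE !vT ?valM.
Qed.

Definition mcq_of_sub : mcq := MCQ sub_mcqP.

End SubMCQ.

Section Decomposition.
Variable X : mcq.

Definition connected_sub_mcq (Y : set (elt X)) : Prop :=
  exists subY : sub_mcq Y, connected_mcq (mcq_of_sub subY).

Definition maximal_connected_sub_mcq (Y : set (elt X)) : Prop :=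
  connected_sub_mcq Y /\
  forall Z : set (elt X), connected_sub_mcq Z -> Y `<=` Z -> Z = Y.

Definition maximal_connected_decomposition
    (I : Type) (D : set I) (A : I -> set (elt X)) : Prop :=
  [/\ \bigcup_(i in D) A i = setT, trivIset D A &
      forall i, D i -> maximal_connected_sub_mcq (A i)].

Definition union_of (L : set (idx X)) : set (elt X) :=
  [set x | L (projT1 x)].

(* The set Orb_L(m), for m : idx (mcq_of_sub subL), i.e. for m in L. *)
Definition Orb_in (L : set (idx X)) (subL : sub_mcq (union_of L))
    (m : idx (mcq_of_sub subL)) : set (idx X) :=
  sval @` Orb m.

(* The existential over the (unique) proof that union_of L is a sub-MCQ is
   harmless: split_orbits is only meant for families of such subsets L. *)
Definition split_orbits (A : set (set (idx X))) : set (set (idx X)) :=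
  \bigcup_(L in A) [set O | exists (subL : sub_mcq (union_of L))
                               (m : idx (mcq_of_sub subL)), O = Orb_in m].

End Decomposition.

(* Main.v *)
(* Each D^n({Lambda}) is a partition of Lambda into sub-MCQs, and D^(n+1) refines
   D^n. If the two agree, every block is its own unique orbit, hence connected.
   A connected sub-MCQ Z lying over a block L lies over a single orbit of L, since
   the orbits of L are invariant under translations by elements of Z; so for every n
   it lies over one block of D^n, which gives maximality. For finite Lambda the
   decreasing sequence of the equivalence relations of D^n is stationary. *)
Require Import Defs.
From mathcomp Require Import all_boot.
From mathcomp Require Import boolp classical_sets cardinality.

Local Open Scope classical_set_scope.

Set Implicit Arguments.
Unset Strict Implicit.
Unset Printing Implicit Defensive.

(** * Orbits of the inner automorphism group on indices *)

Section Orbits.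
Variable X : mcq.
Implicit Types (l m : idx X) (x a : elt X).

Lemma aut_subgroup_Inn : aut_subgroup (@Inn X).
Proof.
split.
- move=> f; apply; split; first exact: aut_subgroup_aut.
  by move=> _ [a _ <-]; exact: translation_aut.
- by move=> H [[]].
- move=> f g Hf Hg H HP; case: (HP) => -[_ _ comp _] _.
  by apply: comp; [exact: Hf | exact: Hg].
- move=> f g Hf fK gK H HP; case: (HP) => -[_ _ _ inv] _.
  by apply: inv fK gK; exact: Hf.
Qed.

Lemma Inn_translation a : Inn (translation a).
Proof. by move=> H [_]; apply; exists a. Qed.

Lemma Orb_refl m : Orb m m.
Proof. by exists id => //; case: aut_subgroup_Inn. Qed.

Lemma Orb_sym l m : Orb m l -> Orb l m.
Proof.
have [autI _ _ inv] := aut_subgroup_Inn.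
move=> [g Ig lE]; have [[h gK hK] _ _] := autI g Ig.
by exists h; [exact: inv Ig gK hK | rewrite lE gK].
Qed.

Lemma Orb_trans l m k : Orb m l -> Orb l k -> Orb m k.
Proof.
have [_ _ comp _] := aut_subgroup_Inn.
by move=> [g Ig lE] [h Ih kE]; exists (h \o g); [exact: comp | rewrite kE lE].
Qed.

Lemma Orb_op x a : Orb (projT1 x) (projT1 (op x a)).
Proof.
exists (translation a); first exact: Inn_translation.
case xaE : (op x a) => [m b]; case: x xaE => l x xaE /=.
by rewrite (aut_unit (translation_aut a) xaE).
Qed.

(** The automorphisms that preserve [P] on indices in both directions form a subgroup containing all
    translations, hence all of [Inn]; stating it as an equivalence gives closure under inverses. *)
Lemma Orb_invariant (P : set (idx X)) :
  (forall x a, P (projT1 (op x a)) <-> P (projT1 x)) ->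
  forall l m, Orb m l -> P m -> P l.
Proof.
move=> Pop l m [g Ig lE] Pm.
pose H := [set f : elt X -> elt X |
  is_aut f /\ forall x, P (projT1 (f x)) <-> P (projT1 x)].
have [autT idT compT invT] := aut_subgroup_aut X.
have subH : aut_subgroup H.
  split.
  - by move=> f [].
  - by split.
  - move=> f k [autf Pf] [autk Pk]; split; first exact: compT.
    by move=> x; apply: iff_trans (Pk _) (Pf x).
  - move=> f k [autf Pf] fK kK; split; first exact: invT autf fK kK.
    by move=> x; rewrite -{2}(kK x); apply: iff_sym.
have [_ Pg] : H g.
  apply: Ig; split=> // _ [a _ <-]; split; first exact: translation_aut.
  by move=> x; exact: Pop.
have := Pg (unit_at m); rewrite -lE /=.
by case=> _; apply.
Qed.

End Orbits.

(** * Orbits inside a sub-MCQ that is a union of whole groups *)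

Section SubOrbits.
Variable X : mcq.

Lemma sub_val_op (Y : set (elt X)) (subY : sub_mcq Y)
    (u v : elt (mcq_of_sub subY)) :
  sub_val (op u v) = op (sub_val u) (sub_val v).
Proof. exact: sub_mkK. Qed.

(** A nonempty fibre of [union_of L] is a whole group, so the subgroup condition is automatic. *)
Lemma sub_mcq_union_of (L : set (idx X)) :
    L !=set0 ->
    (forall x y, union_of L x -> union_of L y -> union_of L (op x y)) ->
  sub_mcq (union_of L).
Proof.
move=> [l Ll] Lop; split=> //; first by exists (unit_at l).
move=> m [c Lm]; have Lm' (a : grp X m) : a \in mem (@fibre X (union_of L) m).
  by rewrite inE.
by split=> // a b _ _; exact: Lm'.
Qed.

Variables (L : set (idx X)) (subL : sub_mcq (union_of L)).

Implicit Type m : idx (mcq_of_sub subL).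

Lemma Orb_in_sub m : Orb_in m `<=` L.
Proof. by move=> _ [[l [a La]] _ <-]. Qed.

Lemma Orb_in_refl m : Orb_in m (sval m).
Proof. by exists m => //; exact: Orb_refl. Qed.

Lemma sub_idx_inj (i j : idx (mcq_of_sub subL)) : sval i = sval j -> i = j.
Proof.
case: i j => [i p] [j q] /= ij; subst j.
by rewrite (Prop_irrelevance p q).
Qed.

Lemma Orb_in_meet m m' l :
  Orb_in m l -> Orb_in m' l ->
  Orb_in m = Orb_in m'.
Proof.
move=> [k mk kl] [k' mk' k'l].
have kk' : k' = k by apply: sub_idx_inj; rewrite kl.
rewrite {k'}kk' in mk' k'l.
by apply/seteqP; split=> _ [i mi <-]; exists i => //;
  (apply: Orb_trans mi; apply: Orb_trans (Orb_sym _); [|eassumption]).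
Qed.

(** Lifted to the sub-MCQ over [L], [x] and [op x a] have indices in one orbit by [Orb_op];
    injectivity of [sval] on indices carries this back. *)
Lemma Orb_in_op m x a : union_of L x -> union_of L a ->
  Orb_in m (projT1 (op x a)) <-> Orb_in m (projT1 x).
Proof.
move=> Lx La.
pose u : elt (mcq_of_sub subL) := sub_mk subL Lx.
pose v : elt (mcq_of_sub subL) := sub_mk subL La.
have uE : sub_val u = x := sub_mkK subL Lx.
have vE : sub_val v = a := sub_mkK subL La.
have uvE : sval (projT1 (op u v)) = projT1 (op x a).
  by rewrite -uE -vE -sub_val_op.
have xE : sval (projT1 u) = projT1 x by rewrite -uE.
rewrite -uvE -xE.
have uv := Orb_op u v.
split=> -[k mk /sub_idx_inj kE]; rewrite kE in mk.
  by exists (projT1 u) => //; exact: Orb_trans mk (Orb_sym uv).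
by exists (projT1 (op u v)) => //; exact: Orb_trans mk uv.
Qed.

Lemma sub_mcq_Orb_in m : sub_mcq (union_of (Orb_in m)).
Proof.
apply: sub_mcq_union_of; first by exists (sval m); exact: Orb_in_refl.
by move=> x y mx my; apply/(Orb_in_op m (Orb_in_sub mx) (Orb_in_sub my)).
Qed.

(* Translations by elements of Z preserve the orbits of L, hence so does Inn(Z);
   no extension of the automorphisms of Z to L is needed. *)
Lemma connected_sub_Orb_in (Z : set (elt X)) (subZ : sub_mcq Z) m z :
    connected_mcq (mcq_of_sub subZ) -> Z `<=` union_of L ->
    Z z -> Orb_in m (projT1 z) ->
  Z `<=` union_of (Orb_in m).
Proof.
move=> connZ ZL Zz mz y Zy.
(* The orbit is pulled back to the indices of [Z], so that [Orb_invariant] applies inside [Z]. *)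
pose P := [set i : idx (mcq_of_sub subZ) | Orb_in m (sval i)].
have PE x (Zx : Z x) :
    P (projT1 (sub_mk subZ Zx)) = Orb_in m (projT1 x).
  by case: x Zx.
rewrite /union_of /mkset -(PE y Zy).
apply: (Orb_invariant (P:=P) _ (connZ (projT1 (sub_mk subZ Zz)) _)).
  move=> u v; have ZLu (w : elt (mcq_of_sub subZ)) : union_of L (sub_val w).
    exact: ZL (sub_valP w).
  by have := Orb_in_op m (ZLu u) (ZLu v); rewrite -sub_val_op.
by rewrite PE.
Qed.

End SubOrbits.

(** * The iterated families of blocks *)

Section Iterates.
Variable X : mcq.

Local Notation D n := (iter n (@split_orbits X) [set [set: idx X]]).

Lemma sub_mcq_iter n L : D n L -> L !=set0 -> sub_mcq (union_of L).
Proof.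
case: n => [-> L0|n [K _ [subK [m ->]]] _]; last exact: sub_mcq_Orb_in.
exact: sub_mcq_union_of.
Qed.

(** Level 0 is excluded: its only block is the whole index set, which may be empty. *)
Lemma iter_neq0 n L : D n.+1 L -> L !=set0.
Proof. by move=> [K _ [subK [m ->]]]; exists (sval m); exact: Orb_in_refl. Qed.

(** Common inductive step of [iter_cover] and [iter_connected]; the point [x] makes [L] nonempty,
    also at level 0. *)
Lemma iter_split n L (x : elt X) : D n L -> L (projT1 x) ->
  exists (subL : sub_mcq (union_of L)) (m : idx (mcq_of_sub subL)),
    D n.+1 (Orb_in m) /\ sval m = projT1 x.
Proof.
move=> DL Lx; have subL : sub_mcq (union_of L).
  by apply: (sub_mcq_iter DL); exists (projT1 x).
exists subL, (projT1 (sub_mk subL (Lx : union_of L x))); split; last by case: x Lx.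
by exists L => //; exists subL; eexists.
Qed.

Lemma iter_cover n l : exists2 L, D n L & L l.
Proof.
elim: n => [|n [L DL Ll]]; first by exists setT.
have [subL [m [Dm ml]]] := iter_split (x := unit_at l) DL Ll.
by exists (Orb_in m) => //; rewrite -[l]ml; exact: Orb_in_refl.
Qed.

Lemma iter_disjoint n L K l : D n L -> D n K -> L l -> K l -> L = K.
Proof.
elim: n L K => [L K -> -> //|n IH L K].
move=> [L' DL' [subL' [m ->]]] [K' DK' [subK' [k ->]]] ml kl.
have LK := IH _ _ DL' DK' (Orb_in_sub ml) (Orb_in_sub kl); subst K'.
(* Identifying the two sub-MCQ proofs puts both orbits over the same index type. *)
rewrite (Prop_irrelevance subK' subL') in k kl *.
exact: Orb_in_meet ml kl.
Qed.

Lemma iter_connected n (Z : set (elt X)) : connected_sub_mcq Z ->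
  exists2 L, D n L & Z `<=` union_of L.
Proof.
move=> [subZ connZ]; have [z Zz] := sub_neq0 subZ.
elim: n => [|n [L DL ZL]]; first by exists setT.
have [subL [m [Dm mz]]] := iter_split DL (ZL _ Zz).
exists (Orb_in m) => //; apply: (connected_sub_Orb_in connZ ZL Zz).
by rewrite -mz; exact: Orb_in_refl.
Qed.

(** The orbit of any [m] in [L] is a block of level [n.+1], hence of level [n]; it meets [L] at [m],
    so disjointness forces it to be all of [L]. *)
Lemma fixed_iter_connected n L :
  D n = D n.+1 -> D n L -> connected_sub_mcq (union_of L).
Proof.
move=> Dfix DL; have [l Ll] : L !=set0 by rewrite Dfix in DL; exact: iter_neq0 DL.
have subL : sub_mcq (union_of L) by apply: (sub_mcq_iter DL); exists l.
exists subL => m k.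
have Dm : D n (Orb_in m) by rewrite Dfix; exists L => //; exists subL, m.
have mL : Orb_in m = L.
  by apply: iter_disjoint Dm DL (Orb_in_refl m) _; exact: Orb_in_sub (Orb_in_refl m).
have : Orb_in m (sval k) by rewrite mL; exact: Orb_in_sub (Orb_in_refl k).
by move=> [i mi /sub_idx_inj <-].
Qed.

Lemma fixed_iter_decomposition n : D n = D n.+1 ->
  maximal_connected_decomposition (D n) (@union_of X).
Proof.
move=> Dfix; split.
- apply/seteqP; split=> // x _; have [L DL Lx] := iter_cover n (projT1 x).
  by exists L.
- by move=> L K DL DK [x [Lx Kx]]; exact: iter_disjoint DL DK Lx Kx.
- move=> L DL; have connL := fixed_iter_connected Dfix DL; split=> // Z connZ LZ.
  (* [Z] lies over a single block [K] and contains [union_of L], so [K] meets [L] and equals it. *)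
  have [K DK ZK] := iter_connected n connZ.
  have [subL _] := connL; have [x Lx] := sub_neq0 subL.
  have LK : L = K := iter_disjoint DL DK Lx (ZK _ (LZ _ Lx)).
  by apply/seteqP; split=> //; rewrite LK.
Qed.

End Iterates.

(** * Stationarity over a finite index set *)

Lemma decreasing_finite_stationary (T : Type) (F : nat -> set T) :
  finite_set [set: T] -> (forall n, F n.+1 `<=` F n) ->
  exists n, F n = F n.+1.
Proof.
move=> finT Fdecr.
have Fmono i j : i <= j -> F j `<=` F i.
  by move=> /subnK <-; elim: (j - i) => // k IH t /Fdecr /IH.
(* [N t] is a stage at which [t] is absent, or 0 if [t] lies in every [F k]; at the maximum of [N]
   only permanent elements remain. *)
have [N NP] : {N : T -> nat & forall t, F (N t) t -> forall k, F k t}.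
  apply: (@choice _ _ (fun t i => F i t -> forall k, F k t)) => t.
  have [Ft|/existsNP[k nFt]] := pselect (forall k, F k t).
    by exists 0.
  by exists k.
have /finite_seqP[s Ns] := finite_image N finT.
exists (\max_(i <- s) i); apply/seteqP; split; last exact: Fdecr.
move=> t Ft; apply: NP; apply: Fmono Ft.
have Nts : N t \in s.
  by have : (N @` setT) (N t) by [exists t]; rewrite Ns.
exact: (leq_bigmax_seq (F := id)) Nts isT.
Qed.

Lemma finite_iter_fixed (X : mcq) : finite_set [set: idx X] ->
  exists n, iter n (@split_orbits X) [set [set: idx X]] =
            iter n.+1 (@split_orbits X) [set [set: idx X]].
Proof.
move=> finX; pose D n := iter n (@split_orbits X) [set [set: idx X]].
pose F n := [set p : idx X * idx X | exists L, [/\ D n L, L p.1 & L p.2]].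
(* The shift to level 1 matters: over an empty index set, levels 0 and 1 have the same relation but
   differ, level 0 containing the empty block. *)
have [||n FE] := @decreasing_finite_stationary _ (fun n => F n.+1).
- by have := finite_setX finX finX; rewrite setXTT.
- move=> n p [_ [[L DL [subL [m ->]]] m1 m2]].
  by exists L; split=> //; [exact: Orb_in_sub m1 | exact: Orb_in_sub m2].
(* A nonempty block is a class of [F k], so from level 1 on equal relations give equal families. *)
have blockE k L l : D k L -> L l -> L = [set x | F k (l, x)].
  move=> DL Ll; apply/seteqP; split=> x; first by exists L.
  by move=> [K [DK Kl Kx]]; rewrite (iter_disjoint DL DK Ll Kl).
exists n.+1; apply/seteqP; split=> L DL; have [l Ll] := iter_neq0 DL.
- have [K DK Kl] := iter_cover n.+2 l.
  by rewrite (blockE _ _ _ DL Ll) FE -(blockE _ _ _ DK Kl).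
- have [K DK Kl] := iter_cover n.+1 l.
  by rewrite (blockE _ _ _ DL Ll) -FE -(blockE _ _ _ DK Kl).
Qed.

Unset Implicit Arguments.

Theorem theorem5 (X : mcq) :
  (forall n : nat,
      iter n (@split_orbits X) [set [set: idx X]] = iter n.+1 (@split_orbits X) [set [set: idx X]] ->
      maximal_connected_decomposition
        (iter n (@split_orbits X) [set [set: idx X]]) (@union_of X)) /\
  (finite_set [set: idx X] ->
   exists n : nat,
     maximal_connected_decomposition
       (iter n (@split_orbits X) [set [set: idx X]]) (@union_of X)).
Proof.
split=> [n|/finite_iter_fixed[n Dfix]]; first exact: fixed_iter_decomposition.
by exists n; exact: fixed_iter_decomposition.
Qed.
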